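(* Let $H$ be a cubic graph that is $2$-connected but not $3$-connected, and suppose $H$ is planar and bipartite. Then $K'(H,3)=1$.
   Context: Graphs are finite; multiple edges are allowed, loops are not. A proper $n$-edge coloring assigns to each edge a color from $\{1,\dots,n\}$ so that edges sharing an endpoint receive different colors. For a proper edge coloring and two distinct colors $a,b$, an edge-Kempe chain is a connected component of the subgraph formed by the edges colored $a$ or $b$; an edge-Kempe switch interchanges the colors $a$ and $b$ on one such chain, producing another proper edge coloring. Two proper $n$-edge colorings are edge-Kempe equivalent ($\sim$) if one can be obtained from the other by a finite sequence of edge-Kempe switches. $K'(G,n)$ denotes the number of edge-Kempe equivalence classes of proper $n$-edge colorings of $G$. *)

(* Defs.v *)
From mathcomp Require Import all_boot all_fingroup.
Set Implicit Arguments. Unset Strict Implicit. Unset Printing Implicit Defensive.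

(* A finite multigraph: vertex type V, edge type E, each edge e has
   endpoints src e and tgt e.  Multiple edges are allowed (several edges
   with the same endpoints); loops are excluded by the hypothesis
   [loopless] in the theorem. *)
Section Graphs.
Variables (V E : finType) (src tgt : E -> V).

Definition loopless : Prop := forall e, src e != tgt e.

Definition incident (e : E) (v : V) : bool := (src e == v) || (tgt e == v).

Definition cubic : Prop := forall v : V, #|[set e | incident e v]| = 3.

Definition share_end (e f : E) : bool := [exists v, incident e v && incident f v].

Definition adj_without (S : {set V}) : rel V :=
  fun u v => [&& u \notin S, v \notin S &
              [exists e, ((src e == u) && (tgt e == v)) ||
                         ((src e == v) && (tgt e == u))]].

Definition connected_without (S : {set V}) : Prop :=
  forall u v, u \notin S -> v \notin S -> connect (adj_without S) u v.

Definition k_connected (k : nat) : Prop :=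
  k < #|V| /\ forall S : {set V}, #|S| < k -> connected_without S.

Definition bipartite : Prop :=
  exists side : V -> bool, forall e, side (src e) != side (tgt e).

Definition dart_vertex (d : E * bool) : V := if d.2 then src d.1 else tgt d.1.
Definition dart_rev (d : E * bool) : E * bool := (d.1, ~~ d.2).

Definition rotation_system (sigma : {perm E * bool}) : Prop :=
  (forall d, dart_vertex (sigma d) = dart_vertex d) /\
  (forall d d', dart_vertex d = dart_vertex d' -> fconnect sigma d d').

Definition face_perm (sigma : {perm E * bool}) (d : E * bool) : E * bool :=
  sigma (dart_rev d).

Definition num_faces (sigma : {perm E * bool}) : nat :=
  #|[set [set d' | fconnect (face_perm sigma) d d'] | d : E * bool]|.

(* Planarity of a connected graph (Heffter-Edmonds-Ringel): some rotation
   system has Euler characteristic V - E + F = 2. *)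
Definition planar : Prop :=
  exists sigma : {perm E * bool},
    rotation_system sigma /\ #|V| + num_faces sigma = #|E| + 2.

Definition proper_coloring (n : nat) (c : {ffun E -> 'I_n}) : bool :=
  [forall e, forall f, ((e != f) && share_end e f) ==> (c e != c f)].

Definition ab_adj (n : nat) (c : {ffun E -> 'I_n}) (a b : 'I_n) : rel E :=
  fun e f => [&& (c e == a) || (c e == b), (c f == a) || (c f == b) &
                 share_end e f].

Definition kempe_chain (n : nat) (c : {ffun E -> 'I_n}) (a b : 'I_n) (e0 : E)
  : {set E} := [set f | connect (ab_adj c a b) e0 f].

Definition kempe_switch (n : nat) (c : {ffun E -> 'I_n}) (a b : 'I_n)
  (K : {set E}) : {ffun E -> 'I_n} :=
  [ffun e => if e \in K then (if c e == a then b else a) else c e].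

Definition kempe_step (n : nat) (c c' : {ffun E -> 'I_n}) : bool :=
  [exists a, exists b, exists e0,
     [&& a != b, (c e0 == a) || (c e0 == b) &
         c' == kempe_switch c a b (kempe_chain c a b e0)]].

Definition kempe_equiv (n : nat) (c c' : {ffun E -> 'I_n}) : bool :=
  connect (@kempe_step n) c c'.

Definition kempe_classes (n : nat) : nat :=
  #|[set [set c' | proper_coloring c' && kempe_equiv c c']
      | c in [set c : {ffun E -> 'I_n} | proper_coloring c]]|.

End Graphs.

(* Main.v *)
Require Import Defs.
From mathcomp Require Import all_boot all_fingroup.
From mathcomp Require Import all_algebra.
Set Implicit Arguments. Unset Strict Implicit. Unset Printing Implicit Defensive.

Import GRing.Theory.

(* Colour with Z/3 and let the turn of a vertex record whether the colours
   increase along the rotation there; twisted by the bipartition, the turn is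
   constant exactly for the colourings that come from the proper 3-colouring of
   the faces. Call an edge singular if the twisted turns of its ends differ. For
   each colour [a], every face has evenly many singular edges coloured [a], and
   on the sphere such a set of edges is a cut. No edge of another colour crosses
   the cut, so one of its sides is a union of chains in the other two colours;
   switching them makes all edges coloured [a] nonsingular and leaves the status
   of the other edges unchanged. Hence every colouring is equivalent to one
   without singular edges, and those differ by a permutation of the colours. The
   same fact about cuts, with coefficients in Z/3, yields one such colouring. *)

(** * Kempe switches on unions of chains *)

Section KempeSwitching.
Variables (V E : finType) (src tgt : E -> V) (n : nat).
Implicit Types (c : {ffun E -> 'I_n}) (a b : 'I_n) (K : {set E}).

Lemma kempe_switchE c a b K e :
  kempe_switch c a b K e = if e \in K then (if c e == a then b else a) else c e.
Proof. by rewrite ffunE. Qed.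

Lemma ab_adj_sym c a b : symmetric (ab_adj src tgt c a b).
Proof.
move=> e f; rewrite /ab_adj /share_end andbCA.
by congr [&& _, _ & _]; apply: eq_existsb => v; rewrite andbC.
Qed.

Lemma kempe_switch_ab c a b K e :
    a != b -> {in K, forall e, (c e == a) || (c e == b)} ->
  (kempe_switch c a b K e == a) || (kempe_switch c a b K e == b)
    = (c e == a) || (c e == b).
Proof.
move=> ab abK; rewrite kempe_switchE; case: ifP => // /abK.
by case: (c e == a); rewrite ?eqxx ?orbT.
Qed.

Lemma ab_adj_switch c a b K :
    a != b -> {in K, forall e, (c e == a) || (c e == b)} ->
  ab_adj src tgt (kempe_switch c a b K) a b =2 ab_adj src tgt c a b.
Proof. by move=> ab abK e f; rewrite /ab_adj !kempe_switch_ab. Qed.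

Lemma kempe_chain_ab c a b e0 :
    (c e0 == a) || (c e0 == b) ->
  {in kempe_chain src tgt c a b e0, forall e, (c e == a) || (c e == b)}.
Proof.
move=> abe0 e; rewrite inE => /connectP[p + ->].
by elim: p e0 abe0 => //= f p IH e0 _ /andP[/and3P[_ + _]]; apply: IH.
Qed.

Lemma kempe_switchK c a b K :
    a != b -> {in K, forall e, (c e == a) || (c e == b)} ->
  kempe_switch (kempe_switch c a b K) a b K = c.
Proof.
move=> ab abK; apply/ffunP => e; rewrite !kempe_switchE.
case eK: (e \in K) => //; case: (c e =P a) (abK _ eK) => [-> _ | _ /= /eqP ->].
  by rewrite (eq_sym b) (negPf ab).
by rewrite eqxx.
Qed.

(** A switch preserves the set of edges coloured [a] or [b], hence the chains, so switching the same
    chain again undoes it. *)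
Lemma kempe_step_sym : symmetric (@kempe_step V E src tgt n).
Proof.
suff imp c c' : kempe_step src tgt c c' -> kempe_step src tgt c' c.
  by move=> c c'; apply/idP/idP; apply: imp.
move=> /existsP[a /existsP[b /existsP[e0 /and3P[ab abe0 /eqP->]]]].
have abK := kempe_chain_ab abe0.
apply/existsP; exists a; apply/existsP; exists b; apply/existsP; exists e0.
rewrite ab kempe_switch_ab // abe0 /=.
set c1 := kempe_switch c a b _.
suff -> : kempe_chain src tgt c1 a b e0 = kempe_chain src tgt c a b e0.
  by rewrite kempe_switchK.
by apply/setP => f; rewrite !inE (eq_connect (ab_adj_switch ab abK)).
Qed.

Lemma kempe_equiv_sym : symmetric (@kempe_equiv V E src tgt n).
Proof. by apply: sym_connect_sym; apply: kempe_step_sym. Qed.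

Lemma kempe_equiv_trans : transitive (@kempe_equiv V E src tgt n).
Proof. by move=> c1 c2 c3; apply: connect_trans. Qed.

(** Such a [K] is a union of chains. By induction on its size, one chain [C] is switched first and
    then [K :\: C], which is still closed under adjacency. *)
Lemma kempe_equiv_switch c a b K :
    a != b -> {in K, forall e, (c e == a) || (c e == b)} ->
    (forall e f, ab_adj src tgt c a b e f -> e \in K -> f \in K) ->
  kempe_equiv src tgt c (kempe_switch c a b K).
Proof.
move=> ab; have [m] := ubnP #|K|; elim: m => // m IH in c K * => leKm abK clK.
have [-> | [e0 e0K]] := set_0Vmem K.
  suff -> : kempe_switch c a b set0 = c by apply: connect0.
  by apply/ffunP => e; rewrite kempe_switchE inE.
pose C := kempe_chain src tgt c a b e0; pose c1 := kempe_switch c a b C.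
have abC : {in C, forall e, (c e == a) || (c e == b)} by apply/kempe_chain_ab/abK.
have CK : C \subset K.
  apply/subsetP => f; rewrite inE => /connectP[p + ->].
  by elim: p e0 e0K {C c1 abC} => //= f' p IHp e0 e0K /andP[/clK/(_ e0K)/IHp].
have e0C : e0 \in C by rewrite inE.
have clC e f : ab_adj src tgt c a b e f -> (f \in C) = (e \in C).
  move=> ef; rewrite !inE; apply/idP/idP => /connect_trans; apply.
    by apply: connect1; rewrite ab_adj_sym.
  exact: connect1.
have -> : kempe_switch c a b K = kempe_switch c1 a b (K :\: C).
  apply/ffunP => e; rewrite !kempe_switchE in_setD.
  by case eC: (e \in C); rewrite //= (subsetP CK _ eC).
apply: (@connect_trans _ _ c1).
  apply: connect1; apply/existsP; exists a; apply/existsP; exists b.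
  by apply/existsP; exists e0; rewrite ab abK //= eqxx.
apply: IH.
- apply: leq_trans (_ : #|K :\: C| < #|K|) _; last exact: leKm.
  apply: proper_card; apply/properP; split; first exact: subsetDl.
  by exists e0; rewrite // in_setD e0C.
- by move=> e /setDP[eK _]; rewrite kempe_switch_ab // abK.
move=> e f; rewrite ab_adj_switch // => ef /setDP[eK eC].
by rewrite in_setD (clC _ _ ef) eC (clK _ _ ef).
Qed.

End KempeSwitching.
(** The left kernel lies in the span of the all-ones row, so its dimension is at most 1. *)
Lemma rank_constant_ker (F : fieldType) m n (A : 'M[F]_(m, n)) :
    (forall v : 'rV_m, v *m A = 0 -> forall i j, v 0 i = v 0 j)%R ->
  m <= (\rank A).+1.
Proof.
move=> constA; rewrite -addn1 -leq_subLR -mxrank_ker.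
suff /mxrankS/leq_trans: (kermx A <= (const_mx 1%R : 'rV[F]_m))%MS.
  by apply; apply: rank_leq_row.
apply/rV_subP => v /sub_kermxP/constA {A constA}; case: m v => [|m] v vE.
  by rewrite thinmx0 sub0mx.
apply/sub_rVP; exists (v 0 0)%R; apply/rowP => i.
by rewrite !mxE mulr1; apply: vE.
Qed.

(** * Faces, cocycles and coboundaries of a connected map *)

Section Maps.
Variables (V E : finType) (src tgt : E -> V) (sigma : {perm E * bool}).
Hypotheses (conn : connected_without src tgt set0)
           (rot : rotation_system src tgt sigma).
Notation vert := (dart_vertex src tgt).
Notation rev := (@dart_rev E).
Notation face := (face_perm sigma).
Notation face_set d := [set d' | fconnect (face_perm sigma) d d'].
Implicit Types d : E * bool.

Lemma dart_revK : involutive rev.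
Proof. by case=> e b; rewrite /dart_rev negbK. Qed.

Lemma vert_sigma d : vert (sigma d) = vert d.
Proof. by case: rot. Qed.

Lemma vert_face d : vert (face d) = vert (rev d).
Proof. exact: vert_sigma. Qed.

Lemma face_inj : injective face.
Proof. by move=> d d' /perm_inj/(can_inj dart_revK). Qed.

Lemma face_set_face d x : (face x \in face_set d) = (x \in face_set d).
Proof. by rewrite !inE -(same_fconnect1_r face_inj). Qed.

(** The orbits of [sigma] are the dart sets of the vertices and [rev] crosses edges, so by
    connectedness the two act transitively on darts. *)
Lemma dart_constant (T : Type) (h : E * bool -> T) :
    (forall d, h (sigma d) = h d) -> (forall d, h (rev d) = h d) ->
  forall d d', h d = h d'.
Proof.
move=> hsigma hrev.
have hvert d d' : vert d = vert d' -> h d = h d'.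
  case: rot => _ /[apply]/connectP[p + ->].
  elim: p d => //= x p IH d /andP[/eqP <- /IH <-].
  by rewrite hsigma.
move=> d d'; have /connectP[p] : connect (adj_without src tgt set0) (vert d) (vert d').
  by apply: conn; rewrite inE.
elim: p d => [|x p IH] d /=; first by move=> _ /esym/hvert.
case/andP=> /and3P[_ _ /existsP[e exy]] pth lst.
have [b [bd bx]] : exists b, vert (e, b) = vert d /\ vert (e, ~~ b) = x.
  by case/orP: exy => /andP[/eqP <- /eqP <-]; [exists true | exists false].
rewrite (hvert d (e, b)) // -hrev; apply: IH; by rewrite /dart_rev /= bx.
Qed.

Local Open Scope ring_scope.

Lemma face_sum_shift (R : zmodType) (T : E * bool -> R) d :
  \sum_(x in face_set d) T (face x) = \sum_(x in face_set d) T x.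
Proof.
by rewrite [RHS](reindex_inj face_inj); apply: eq_bigl => x; rewrite face_set_face.
Qed.

Lemma sum_darts (R : zmodType) (T : E * bool -> R) (A : {set E * bool}) :
    (forall d, T (rev d) = - T d) ->
  \sum_(d in A) T d =
  \sum_e (T (e, true) *+ ((e, true) \in A) - T (e, true) *+ ((e, false) \in A)).
Proof.
move=> Trev; rewrite big_mkcond.
transitivity (\sum_e \sum_b if (e, b) \in A then T (e, b) else 0).
  by rewrite pair_bigA; apply: eq_bigr => -[].
apply: eq_bigr => e _; rewrite big_bool -mulNrn -(Trev (e, true)) /dart_rev /=.
by do 2!case: (_ \in A).
Qed.

Hypothesis euler : (#|V| + num_faces sigma = #|E| + 2)%N.

(* Coboundaries are cocycles, and the two spaces have the same dimension:
   connectedness of the graph and of its dual bound the ranks of the vertex-edge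
   and edge-face incidence matrices from below by [#|V| - 1] and
   [num_faces sigma - 1], so that Euler's formula leaves no room between them. *)
Lemma cocycle_coboundary (F : fieldType) (tau : E * bool -> F) :
    (forall d, tau (rev d) = - tau d) ->
    (forall d, \sum_(x in face_set d) tau x = 0) ->
  exists g : V -> F, forall d, tau d = g (vert d) - g (vert (rev d)).
Proof.
move=> tau_rev tau_face.
pose Fs := [set face_set d | d : E * bool].
pose cobd := \matrix_(i < #|V|, j < #|E|)
  ((src (enum_val j) == enum_val i)%:R - (tgt (enum_val j) == enum_val i)%:R : F).
pose bd := \matrix_(j < #|E|, k < #|Fs|)
  (((enum_val j, true) \in enum_val k)%:R
     - ((enum_val j, false) \in enum_val k)%:R : F).
pose row_of (T : E * bool -> F) := \row_(j < #|E|) T (enum_val j, true).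
pose dg (g : V -> F) d := g (vert d) - g (vert (rev d)).
have FsP (k : 'I_#|Fs|) : exists d, enum_val k = face_set d.
  by have /imsetP[d _ ->] := enum_valP k; exists d.
have row_bd (T : E * bool -> F) : (forall d, T (rev d) = - T d) ->
    (forall d, \sum_(x in face_set d) T x = 0) -> row_of T *m bd = 0.
  move=> Trev Tface; apply/rowP => k; have [d dk] := FsP k.
  rewrite !mxE -[RHS](Tface d) sum_darts //.
  rewrite [RHS](reindex (fun j : 'I_#|E| => enum_val j)) /=; last first.
    by exists enum_rank => j _; rewrite ?enum_valK ?enum_rankK.
  by apply: eq_bigr => j _; rewrite !mxE dk mulrBr !mulr_natr.
have dg_rev g x : dg g (rev x) = - dg g x by rewrite /dg dart_revK opprB.
have dg_face g y : \sum_(x in face_set y) dg g x = 0.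
  rewrite sumrB -[X in X - _]face_sum_shift; apply/eqP; rewrite subr_eq0; apply/eqP.
  by apply: eq_bigr => x _; rewrite vert_face.
have mul_cobd (u : 'rV_#|V|) :
    u *m cobd = row_of (dg (fun v => u 0 (enum_rank v))).
  apply/rowP => j; rewrite !mxE /dg /dart_rev /dart_vertex /=.
  under eq_bigr do rewrite mxE mulrBr !mulr_natr.
  have pick w : \sum_i u 0 i *+ (w == enum_val i) = u 0 (enum_rank w).
    rewrite (bigD1 (enum_rank w)) //= enum_rankK eqxx big1 ?addr0 // => i.
    by case: (w =P enum_val i) => // ->; rewrite enum_valK eqxx.
  by rewrite sumrB !pick.
have dsub : (cobd <= kermx bd)%MS.
  apply/rV_subP => v /submxP[u ->]; apply/sub_kermxP; rewrite mul_cobd.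
  exact: row_bd.
have rkV : (#|V| <= (\rank cobd).+1)%N.
  apply: rank_constant_ker => u; rewrite mul_cobd => /rowP u0 i j.
  have edge e : u 0 (enum_rank (src e)) = u 0 (enum_rank (tgt e)).
    have := u0 (enum_rank e); rewrite !mxE enum_rankK /dg /dart_rev /dart_vertex /=.
    by move/eqP; rewrite subr_eq0 => /eqP.
  rewrite -(enum_valK i) -(enum_valK j).
  have /connectP[p] : connect (adj_without src tgt set0) (enum_val i) (enum_val j).
    by apply: conn; rewrite inE.
  elim: p (enum_val i) => [|x p IH] y /=; first by move=> _ ->.
  case/andP=> /and3P[_ _ /existsP[e exy]] pth lst; rewrite -(IH x) //.
  by case/orP: exy => /andP[/eqP <- /eqP <-]; rewrite edge.
have rkF : (#|Fs| <= (\rank bd).+1)%N.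
  rewrite -mxrank_tr; apply: rank_constant_ker => u /rowP u0.
  (* Each dart lies in exactly one face, so [h d] is the entry of [u] at the face of [d]. The kernel
     condition equates the two sides of every edge. *)
  pose h d := \sum_(k < #|Fs|) u 0 k *+ (d \in enum_val k).
  have hrev x : h (rev x) = h x.
    have htf e : h (e, true) = h (e, false).
      apply/eqP; rewrite -subr_eq0 -sumrB; apply/eqP.
      have := u0 (enum_rank e); rewrite !mxE => u0e; rewrite -[RHS]u0e; apply: eq_bigr => k _.
      by rewrite !mxE enum_rankK mulrBr !mulr_natr.
    by case: x => e []; rewrite /dart_rev htf.
  have hsigma x : h (sigma x) = h x.
    rewrite -[in LHS](dart_revK x) -[RHS]hrev; apply: eq_bigr => k _.
    by have [y ->] := FsP k; rewrite face_set_face.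
  have hu k : exists d, u 0 k = h d.
    have [d dk] := FsP k; exists d.
    rewrite /h (bigD1 k) //= dk inE connect0 mulr1n big1 ?addr0 // => k' k'k.
    have [d' dk'] := FsP k'; case dd': (d \in enum_val k') => //; case/negP: k'k; apply/eqP.
    apply: enum_val_inj; rewrite dk dk'; apply/setP => x.
    move: dd'; rewrite dk' !inE => /(same_connect (fconnect_sym face_inj)).
    exact.
  move=> i j; have [d ->] := hu i; have [d' ->] := hu j.
  exact: dart_constant.
have : (kermx bd <= cobd)%MS.
  (* With [F] faces, dim ker [bd] is at most E - (F - 1), which is V - 1 by Euler's formula and so
     at most the rank of [cobd]. *)
  rewrite -(mxrank_leqif_sup dsub) eqn_leq (mxrankS dsub) mxrank_ker leq_subLR.
  rewrite -(leq_add2r 2) -euler (leq_trans (leq_add rkV rkF)) //.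
  by rewrite addSn addnS addn2 addnC.
move/(submx_trans (introT sub_kermxP (row_bd _ tau_rev tau_face))).
case/submxP => u; rewrite mul_cobd => /rowP uE.
exists (fun v => u 0 (enum_rank v)) => -[e b].
have tauE : tau (e, true) = dg (fun v => u 0 (enum_rank v)) (e, true).
  by have := uE (enum_rank e); rewrite !mxE enum_rankK.
by case: b => //; rewrite -[(e, false)]/(rev (e, true)) tau_rev tauE -dg_rev.
Qed.

(** * Rotation at the vertices of a cubic map *)

Hypotheses (loopfree : loopless src tgt) (cub : cubic src tgt).

(** Without loops, the darts at a vertex correspond bijectively to its incident edges, and they form
    a single orbit. *)
Lemma order_sigma d : fingraph.order sigma d = 3%N.
Proof.
rewrite -(cub (vert d)) /fingraph.order.
have -> : [set e | incident src tgt e (vert d)]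
    = [set x.1 | x in [set x | vert x == vert d]].
  apply/setP => e; rewrite inE; apply/idP/imsetP => [|[x + ->]].
    by case/orP => ed; [exists (e, true) | exists (e, false)]; rewrite ?inE.
  by rewrite inE /incident /dart_vertex; case: x.2 => ->; rewrite ?orbT.
rewrite card_in_imset => [|[e b] [e' b'] /=].
  apply: eq_card => x; rewrite [in RHS]inE; apply/idP/eqP; last first.
    by case: rot => _ h /esym/h.
  case/connectP=> p + ->; elim: p d => //= y p IH d /andP[/eqP <- /IH ->].
  exact: vert_sigma.
rewrite !inE /dart_vertex /= => /eqP vb /eqP vb' ee'; move: vb vb'; rewrite -{}ee'.
have := loopfree e.
by case: b; case: b' => // /eqP ne v1 v2; case: ne; rewrite v1 v2.
Qed.

Lemma sigma3 d : sigma (sigma (sigma d)) = d.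
Proof. by rewrite -[RHS](iter_order (@perm_inj _ sigma)) order_sigma. Qed.

Lemma orbit_sigma d : fingraph.orbit sigma d = [:: d; sigma d; sigma (sigma d)].
Proof. by rewrite /fingraph.orbit order_sigma. Qed.

Lemma eq_vert d d' : vert d = vert d' -> d' \in [:: d; sigma d; sigma (sigma d)].
Proof. by case: rot => _ /[apply]; rewrite fconnect_orbit orbit_sigma. Qed.

Lemma edge_sigma d : d.1 != (sigma d).1.
Proof.
have := orbit_uniq sigma d; rewrite orbit_sigma /= inE negb_or => /andP[/andP[+ _] _].
apply: contraNneq; have := vert_sigma d; case: d (sigma d) => e b [e' b'] + /= ee'.
rewrite -{}ee' /dart_vertex /=; have := loopfree e.
by case: b; case: b' => //= /eqP ne v1; case: ne; rewrite v1.
Qed.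

(** * Turns of 3-edge-colourings and colour swaps across a cut *)

Implicit Types c : {ffun E -> 'I_3}.

(** Among three darts in cyclic order, any two distinct ones are consecutive in one direction or the
    other. *)
Lemma proper_dartP c :
  reflect (forall d, c d.1 != c (sigma d).1) (proper_coloring src tgt c).
Proof.
have inc d : incident src tgt d.1 (vert d).
  by rewrite /incident /dart_vertex; case: d.2; rewrite eqxx ?orbT.
have incP e v : incident src tgt e v -> exists2 d, d.1 = e & vert d = v.
  by case/orP => /eqP <-; [exists (e, true) | exists (e, false)].
apply: (iffP forallP) => [pc d | pc e].
  have /forallP/(_ (sigma d).1)/implyP := pc d.1; apply; rewrite edge_sigma.
  by apply/existsP; exists (vert d); rewrite -{2}(vert_sigma d) !inc.
apply/forallP => f; apply/implyP => /andP[ef /existsP[v /andP[]]].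
move=> /incP[d dE dv] /incP[d' d'E d'v].
have := @eq_vert d d'; rewrite dv d'v !inE => /(_ erefl); rewrite -dE -d'E in ef *.
case/or3P => /eqP d'd; rewrite d'd ?eqxx // in ef *.
by rewrite -{1}(sigma3 d) eq_sym.
Qed.

(* Independent of the dart chosen at a vertex when [c] is proper: the differences
   along [sigma] are nonzero in Z/3 and sum to 0, hence are equal. *)
Definition turn c d : bool := c (sigma d).1 - c d.1 == 1.

Lemma turn_sigma c d : proper_coloring src tgt c -> turn c (sigma d) = turn c d.
Proof.
move=> /proper_dartP pc; rewrite /turn.
have := pc (sigma (sigma d)); have := pc (sigma d); have := pc d; rewrite sigma3.
case: (c d.1) => [[|[|[|//]]] ?]; case: (c (sigma d).1) => [[|[|[|//]]] ?];
by case: (c (sigma (sigma d)).1) => [[|[|[|//]]] ?].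
Qed.

Lemma color_sigma c d : proper_coloring src tgt c ->
  c (sigma d).1 = c d.1 + (if turn c d then 1 else -1).
Proof.
move=> /proper_dartP/(_ d); rewrite /turn.
by case: (c d.1) => [[|[|[|//]]] ?]; case: (c (sigma d).1) => [[|[|[|//]]] ?];
  rewrite //= => _; apply/val_inj.
Qed.

(* [x |-> - a - x] is the transposition of the two colours other than [a]. *)
Definition swap_on (a : 'I_3) (f : V -> bool) c : {ffun E -> 'I_3} :=
  [ffun e => if f (src e) then - a - c e else c e].

Section Swap.
Variables (a : 'I_3) (f : V -> bool) (c : {ffun E -> 'I_3}).
Hypotheses (pc : proper_coloring src tgt c)
           (fP : forall e, c e != a -> f (src e) = f (tgt e)).

(** Either end of an edge may be read: if [f] differs at the ends, the colour is [a], which the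
    transposition fixes since -2a = a in Z/3. *)
Lemma swap_onE d :
  swap_on a f c d.1 = if f (vert d) then - a - c d.1 else c d.1.
Proof.
case: d => e [] /=; rewrite ffunE //= /dart_vertex /=.
have [ea | /fP -> //] := eqVneq (c e) a; rewrite ea.
have -> : - a - a = a by case: a => [[|[|[|//]]] ?]; apply/val_inj.
by rewrite !if_same.
Qed.

Lemma swap_on_sigma d : swap_on a f c (sigma d).1 =
  if f (vert d) then - a - c (sigma d).1 else c (sigma d).1.
Proof. by rewrite swap_onE vert_sigma. Qed.

Lemma swap_on_proper : proper_coloring src tgt (swap_on a f c).
Proof.
apply/proper_dartP => d; rewrite swap_on_sigma swap_onE.
have := elimT (proper_dartP c) pc d; case: (f _) => //.
by apply: contraNneq => /addrI/oppr_inj/eqP.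
Qed.

(** The map [x |-> - a - x] negates colour differences. *)
Lemma turn_swap_on d : turn (swap_on a f c) d = turn c d (+) f (vert d).
Proof.
rewrite /turn swap_on_sigma swap_onE.
have := elimT (proper_dartP c) pc d; case: (f _); rewrite ?addbF // addbT => _.
rewrite opprD addrACA subrr add0r opprK addrC.
have := elimT (proper_dartP c) pc d; rewrite eq_sym -subr_eq0 -[c d.1 - _]opprB.
by case: (_ - _) => [[|[|[|//]]] ?].
Qed.

(** Edges not coloured [a] do not cross the cut [f], so those on its true side are closed under
    adjacency in the colours [a + 1] and [a - 1]. *)
Lemma kempe_equiv_swap_on : kempe_equiv src tgt c (swap_on a f c).
Proof.
pose K := [set e | (c e != a) && f (src e)].
have ab x : (x == a + 1) || (x == a - 1) = (x != a).
  by move: x a => [[|[|[|//]]] ?] [[|[|[|//]]] ?].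
have -> : swap_on a f c = kempe_switch c (a + 1) (a - 1) K.
  apply/ffunP => e; rewrite kempe_switchE ffunE inE andbC.
  case: (f _) => //=; move: (c e) a => [[|[|[|//]]] ?] [[|[|[|//]]] ?];
  by apply/val_inj.
apply: kempe_equiv_switch => [|e|e g].
- by move: a => [[|[|[|//]]] ?].
- by rewrite inE ab => /andP[].
rewrite /ab_adj !ab !inE => /and3P[ea ga /existsP[v /andP[ev gv]]] /andP[_].
have fv h : c h != a -> incident src tgt h v -> f (src h) = f v.
  by move=> ha /orP[] /eqP <- //; apply: fP.
by rewrite ga (fv e) // (fv g).
Qed.

End Swap.

(** * Bipartite maps: existence of a colouring and removal of singular edges *)

Variable side : V -> bool.
Hypothesis bip : forall e, side (src e) != side (tgt e).

Lemma side_rev d : side (vert (rev d)) = ~~ side (vert d).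
Proof. by case: d => e [] /=; move: (bip e); rewrite /dart_vertex /=; do 2!case: side. Qed.

(** Number the darts around each vertex in Z/3, with a sign given by its side; the cocycle lemma
    provides vertex offsets [g] making the values at both ends of each edge agree. *)
Lemma exists_proper_coloring : exists c, proper_coloring src tgt c.
Proof.
pose pos d : 'F_3 := (findex sigma (froot sigma d) d)%:R.
have pos_sigma d : pos (sigma d) = pos d + 1.
  have symf := fconnect_sym (@perm_inj _ sigma).
  have rd : fconnect sigma (froot sigma d) d by rewrite symf connect_root.
  rewrite /pos -(fingraph.rootP symf (fconnect1 sigma d)) -mulrSr.
  have := findex_max rd; rewrite -[d in sigma d](iter_findex rd) order_sigma.
  move: (froot sigma d) (findex _ _ _) => r k; rewrite leq_eqVlt => /orP[/eqP[->]|k3].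
    (* The numbering wraps around consistently because 2 + 1 = 0 in Z/3. *)
    by rewrite /= sigma3 findex0; apply/val_inj.
  by rewrite -iterS findex_iter // order_sigma.
pose eps d : 'F_3 := if side (vert d) then 1 else -1.
have eps_rev d : eps (rev d) = - eps d.
  by rewrite /eps side_rev; case: (side _); rewrite ?opprK.
have eps_sigma d : eps (sigma d) = eps d by rewrite /eps vert_sigma.
have triple (x : 'F_3) : x + x = - x.
  by case: x => [[|[|[|//]]] ?]; apply/val_inj.
have [|d|g gP] := @cocycle_coboundary _
    (fun d => eps (rev d) * pos (rev d) - eps d * pos d).
- by move=> d; rewrite dart_revK opprB.
(* The correction [- eps (face x)] equals [eps (face x) + eps (face x)] in Z/3, that is
   [eps (face x) - eps x], so it telescopes too. *)
- under eq_bigr => x _.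
    have -> : eps (rev x) * pos (rev x) - eps x * pos x
        = (eps (face x) * pos (face x) + eps (face x)) - (eps x * pos x + eps x).
      rewrite /face_perm pos_sigma eps_sigma mulrDr mulr1 -[_ + _ + eps _]addrA triple.
      by rewrite eps_rev opprK opprD addrACA subrr addr0.
    over.
  by rewrite sumrB (face_sum_shift (fun x => eps x * pos x + eps x)) subrr.
pose col d := g (vert d) + eps d * pos d.
have col_rev d : col (rev d) = col d.
  apply/eqP; rewrite /col -subr_eq0 opprD addrACA -[g _ - g _]opprB -gP.
  by rewrite opprB addrC addrA subrK subrr.
exists [ffun e => col (e, true)]; apply/proper_dartP => d.
have colE x : [ffun e => col (e, true)] x.1 = col x.
  by case: x => e []; rewrite ffunE //= -[RHS]col_rev.
rewrite !colE /col vert_sigma eps_sigma pos_sigma mulrDr mulr1 addrA.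
rewrite eq_sym -subr_eq0 [X in X - _]addrC addrK /eps.
by case: (side _).
Qed.

Definition twist c d := turn c d (+) side (vert d).

Lemma twist_sigma c d : proper_coloring src tgt c -> twist c (sigma d) = twist c d.
Proof. by move=> pc; rewrite /twist turn_sigma // vert_sigma. Qed.

Lemma twist_cut c (a : 'I_3) : proper_coloring src tgt c ->
  exists f : V -> bool, forall d,
    (c d.1 == a) && (twist c d != twist c (rev d)) = (f (vert d) != f (vert (rev d))).
Proof.
move=> pc; pose S d : 'F_2 := ((c d.1 == a) && (twist c d != twist c (rev d)))%:R.
(* For consecutive colours x, y, z along a face, [S] at y is
   [y = a]([x = a + 1] + [z = a + 1]) mod 2. Moving the first term one step along
   the face, the total counts the consecutive pairs {a, a + 1}, and such a pair
   x, y is detected by 1 + [x = a - 1] + [y = a - 1]; the 1 telescopes since sides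
   alternate along the face. *)
pose w d : 'F_2 := ((c d.1 == a) && (c (face d).1 == a + 1))%:R
  + (side (vert d))%:R + (c d.1 == a - 1)%:R.
have telescope d : S (face d) = w (face d) - w d.
  have cE : c (face d).1 = c d.1 + (if turn c (rev d) then 1 else -1) by exact: color_sigma.
  have cE' : c (face (face d)).1
      = c (face d).1 + (if turn c (rev (face d)) then 1 else -1) by exact: color_sigma.
  rewrite /S /w cE' /twist side_rev vert_face side_rev.
  rewrite -[turn c (face d)](turn_sigma _ pc) turn_sigma // /face_perm turn_sigma //.
  rewrite -/(face d) cE {cE cE' S w}.
  case: (turn c (rev (face d))); case: (turn c (rev d)); case: (side _);
  move: (c d.1) a => [[|[|[|//]]] ?] [[|[|[|//]]] ?]; by apply/val_inj.
have [d|d|g gP] := @cocycle_coboundary _ S.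
- rewrite /S dart_revK [twist c (rev d) == _]eq_sym /=; by case: (_ && _); apply/val_inj.
- rewrite -face_sum_shift; under eq_bigr do rewrite telescope.
  by rewrite sumrB face_sum_shift subrr.
(* Over ['F_2] the difference of [g] across an edge is 1 exactly when one end is a zero of [g] and
   the other is not. *)
exists (fun v => g v == 0) => d; have := gP d; rewrite /S.
case: (g _) (g _) => [[|[|//]] ?] [[|[|//]] ?]; by case: (_ && _).
Qed.

Lemma kempe_equiv_untwisted c : proper_coloring src tgt c ->
  exists c', [/\ proper_coloring src tgt c', kempe_equiv src tgt c c'
               & forall d d', twist c' d = twist c' d'].
Proof.
have [m] := ubnP #|[set d | twist c d != twist c (rev d)]|.
elim: m => // m IH in c * => lem pc.
have [s0 | [d0]] := set_0Vmem [set d | twist c d != twist c (rev d)].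
  exists c; split=> //; first exact: connect0.
  apply: dart_constant => d; first exact: twist_sigma.
  by have /setP/(_ d) := s0; rewrite !inE => /negbFE/eqP.
rewrite inE => tw0; have [f fP] := twist_cut (c d0.1) pc.
have fE e : c e != c d0.1 -> f (src e) = f (tgt e).
  by move=> ce; have := fP (e, true); rewrite /= (negPf ce) => /esym/negbFE/eqP.
pose c1 := swap_on (c d0.1) f c; have pc1 : proper_coloring src tgt c1 by exact: swap_on_proper.
(* The swap flips the twist where [f] holds. Among edges of the chosen colour the cut consists
   exactly of the singular ones, which are repaired; no other edge crosses it. *)
have tw1 d : (twist c1 d != twist c1 (rev d))
    = (c d.1 != c d0.1) && (twist c d != twist c (rev d)).
  rewrite /twist !turn_swap_on // addbAC [turn c (rev d) (+) _ (+) _]addbAC.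
  rewrite -/(twist c d) -/(twist c (rev d)).
  have := fP d; case: (c _ =P _) => _ /=.
    by do 2!case: twist; do 2!case: (f _).
  by move=> /esym/negbFE/eqP ->; do 2!case: twist; case: (f _).
have [|c2 [pc2 cc2 tw2]] := IH _ _ pc1.
  rewrite ltnS in lem; apply: leq_trans lem; apply: proper_card; apply/properP; split.
    by apply/subsetP => d; rewrite !inE tw1 => /andP[].
  by exists d0; rewrite !inE // tw1 eqxx.
exists c2; split=> //; apply: kempe_equiv_trans cc2.
exact: kempe_equiv_swap_on.
Qed.

(** Equal turns give equal colour increments around each vertex, so the difference of the colourings
    is invariant under [sigma] and [rev]. *)
Lemma proper_turn_shift c c' : proper_coloring src tgt c -> proper_coloring src tgt c' ->
  turn c =1 turn c' -> exists k, forall e, c' e = c e + k.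
Proof.
move=> pc pc' tt.
have cst : forall d d', c' d.1 - c d.1 = c' d'.1 - c d'.1.
  apply: (@dart_constant _ (fun d => c' d.1 - c d.1)) => d //=.
  by rewrite !color_sigma // tt opprD addrACA subrr addr0.
have [e _ | E0] := pickP E; last by exists 0 => e; have := E0 e.
exists (c' e - c e) => e'; rewrite (cst (e, true) (e', true)) /=.
by rewrite addrC subrK.
Qed.

Lemma proper_kempe_equiv c c' :
    proper_coloring src tgt c -> proper_coloring src tgt c' ->
  kempe_equiv src tgt c c'.
Proof.
move=> /kempe_equiv_untwisted[c1 [pc1 cc1 tw1]] /kempe_equiv_untwisted[c2 [pc2 cc2 tw2]].
apply: (kempe_equiv_trans cc1); rewrite kempe_equiv_sym; apply: (kempe_equiv_trans cc2).
rewrite kempe_equiv_sym {c c' cc1 cc2}.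
have turn_swap a c d : proper_coloring src tgt c ->
    turn (swap_on a xpredT c) d = ~~ turn c d.
  by move=> pc; rewrite turn_swap_on // addbT.
have swapped c : proper_coloring src tgt c -> turn c1 =1 turn c -> kempe_equiv src tgt c1 c.
  move=> pc /(proper_turn_shift pc1 pc)[k ck].
  apply: (@kempe_equiv_trans _ _ _ _ _ (swap_on 0 xpredT c1)).
    exact: kempe_equiv_swap_on.
  (* The shift by [k] is the composite of the reflections x -> -x and x -> k - x. *)
  have -> : c = swap_on (- k) xpredT (swap_on 0 xpredT c1).
    apply/ffunP => e; rewrite !ffunE /= ck opprK oppr0 sub0r opprK.
    by rewrite addrC.
  by apply: kempe_equiv_swap_on => //; apply: swap_on_proper.
have [d0 _ | D0] := pickP (fun _ : E * bool => true); last first.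
  by apply: swapped => // d; have := D0 d.
have [t12 | t12] := eqVneq (twist c1 d0) (twist c2 d0).
  apply: swapped => // d; apply: (@addIb (side (vert d))).
  by rewrite -/(twist c1 d) -/(twist c2 d) (tw1 d d0) (tw2 d d0).
(* Opposite twists: a global transposition of [c2] reverses all its turns. *)
apply: (@kempe_equiv_trans _ _ _ _ _ (swap_on 0 xpredT c2)); last first.
  by rewrite kempe_equiv_sym; apply: kempe_equiv_swap_on.
apply: swapped => [|d]; first exact: swap_on_proper.
rewrite turn_swap //; apply: (@addIb (side (vert d))); rewrite addNb.
rewrite -/(twist c1 d) -/(twist c2 d) (tw1 d d0) (tw2 d d0).
by move: t12; do 2!case: twist.
Qed.

End Maps.

Theorem theorem14 (V E : finType) (src tgt : E -> V)
  (Hloop : loopless src tgt)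
  (Hcubic : cubic src tgt)
  (H2 : k_connected src tgt 2)
  (H3 : ~ k_connected src tgt 3)
  (Hplanar : planar src tgt)
  (Hbip : bipartite src tgt) :
  kempe_classes src tgt 3 = 1.
Proof.
have conn : connected_without src tgt set0 by apply: (proj2 H2); rewrite cards0.
have [sigma [rot euler]] := Hplanar; have [side bip] := Hbip.
have [c0 pc0] := exists_proper_coloring conn rot euler Hloop Hcubic bip.
have eqv := proper_kempe_equiv conn rot euler Hloop Hcubic bip.
apply/eqP/cards1P.
exists [set c : {ffun E -> 'I_3} | proper_coloring src tgt c].
apply/setP => A; rewrite inE; apply/imsetP/eqP => [[c]|->].
  by rewrite inE => pc ->; apply/setP => c'; rewrite !inE; apply/andb_idr/eqv.
exists c0; rewrite ?inE //; apply/setP => c'; rewrite !inE.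
by apply/esym/andb_idr/eqv.
Qed.
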